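(* Let $L$ be a complete lattice and let $\overline\top$ and $x$ be two different elements with $L\cap\{\overline\top,x\}=\varnothing$. Then for every $\gamma\in L$ there exists a unique complete lattice structure on $\overline L^\gamma=L\cup\{\overline\top,x\}$ satisfying the following conditions: (i) $\overline L^\gamma$ is an extension of $L$; (ii) $\overline\top$ is the universal upper bound of $\overline L^\gamma$; (iii) $x$ is isolated in $\overline L^\gamma$ with $x^-=\gamma$ and $x^+=\overline\top$. Moreover, if there exist $\alpha,\beta\in L$ such that $\gamma\wedge(\alpha\vee\beta)\not\le(\gamma\wedge\alpha)\vee(\gamma\wedge\beta)$ in $L$, then in $\overline L^\gamma$ we have $x\wedge(\alpha\vee\beta)\not\le(x\wedge\alpha)\vee(x\wedge\beta)$ and $x\not\le\alpha\vee\beta$; in particular $\overline L^\gamma$ is strictly nondistributive.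
   Context: A complete lattice $M$ is an extension of a complete lattice $L$ (with $L\subseteq M$ as sets) if the inclusion map $L\hookrightarrow M$ preserves arbitrary joins and nonempty meets. For $\alpha$ in a lattice $M$ write $\downarrow\alpha=\{\beta\in M\mid\beta\le\alpha\}$ and $\uparrow\alpha=\{\beta\in M\mid\alpha\le\beta\}$. An element $\alpha\in M\setminus\{\bot,\top_M\}$ is isolated in $M$ if there exist elements $\alpha^-\le\alpha$ and $\alpha^+\ge\alpha$ of $M$ such that $(\downarrow\alpha)\setminus\{\alpha\}=\downarrow\alpha^-$ and $(\uparrow\alpha)\setminus\{\alpha\}=\uparrow\alpha^+$. A lattice $M$ is strictly nondistributive if there exist $\alpha,\beta,x\in M$ such that $x\wedge(\alpha\vee\beta)\not\le (x\wedge\alpha)\vee(x\wedge\beta)$ and $x\not\le\alpha\vee\beta$. *)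

(* Defs.v *)
From mathcomp Require Import all_boot.
From mathcomp Require Import boolp classical_sets.

Set Implicit Arguments.
Unset Strict Implicit.
Unset Printing Implicit Defensive.

Local Open Scope classical_set_scope.

(* Not built on [porderType]: that structure bundles a choice operator, so
   "there is a unique complete lattice structure on T" could not be an equality
   of structures. Here [sup] and [inf] are determined by [le], hence two
   structures are equal as soon as their orders coincide. *)
Record completeLattice (T : Type) := CompleteLattice {
  le : rel T;
  le_refl : reflexive le;
  le_anti : antisymmetric le;
  le_trans : transitive le;
  sup : set T -> T;
  sup_ub : forall (S : set T) a, S a -> le a (sup S);
  sup_le_ub : forall (S : set T) b, (forall a, S a -> le a b) -> le (sup S) b;
  inf : set T -> T;
  inf_lb : forall (S : set T) a, S a -> le (inf S) a;
  lb_le_inf : forall (S : set T) b, (forall a, S a -> le b a) -> le b (inf S)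
}.

Notation "a <=[ M ] b" := (le M a b)
  (at level 70, M at level 200, b at next level, format "a  <=[ M ]  b").

Section Lattice.
Variables (T : Type) (M : completeLattice T).
Implicit Types a b : T.

Definition join a b : T := sup M [set a; b].
Definition meet a b : T := inf M [set a; b].
Definition bot : T := sup M set0.
Definition top : T := inf M set0.

Definition down a : set T := [set b | b <=[M] a].
Definition up a : set T := [set b | a <=[M] b].

(* [a] is isolated, with a^- = am and a^+ = ap (which are unique by
   antisymmetry). *)
Definition isolated_with a am ap : Prop :=
  [/\ a <> bot /\ a <> top,
      am <=[M] a,
      a <=[M] ap,
      down a `\ a = down am &
      up a `\ a = up ap].

Definition strictly_nondistributive : Prop :=
  exists a b x : T,
    ~ (meet x (join a b) <=[M] join (meet x a) (meet x b)) /\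
    ~ (x <=[M] join a b).

End Lattice.

(* A set A : set U, used as a type, is {u : U | u \in A}. *)
Section Extension.
Variables (U : Type) (A B : set U).

Definition elt (u : U) (Au : A u) : A := SigSub (mem_set Au).

Definition inclusion (AB : A `<=` B) (a : A) : B :=
  SigSub (mem_set (AB (val a) (set_mem (valP a)))).

Definition extension (MA : completeLattice A) (MB : completeLattice B) : Prop :=
  exists AB : A `<=` B,
    (forall S : set A,
       inclusion AB (sup MA S) = sup MB (inclusion AB @` S)) /\
    (forall S : set A, S !=set0 ->
       inclusion AB (inf MA S) = inf MB (inclusion AB @` S)).

End Extension.

Section Adjoin.
Variables (U : Type) (L : set U) (t x : U).

Definition adjoin : set U := L `|` [set t; x].

Lemma sub_adjoin : L `<=` adjoin. Proof. by move=> u Lu; left. Qed.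
Lemma adjoin_t : adjoin t. Proof. by right; left. Qed.
Lemma adjoin_x : adjoin x. Proof. by right; right. Qed.

Definition old (a : L) : adjoin := inclusion sub_adjoin a.
Definition new_top : adjoin := elt adjoin_t.
Definition new_x : adjoin := elt adjoin_x.

Definition isolated_adjunction (ML : completeLattice L) (gamma : L)
    (M : completeLattice adjoin) : Prop :=
  [/\ extension ML M,
      forall a : adjoin, a <=[M] new_top &
      isolated_with M new_x (old gamma) new_top].

End Adjoin.

Arguments old {U L} t x a.
Arguments new_top {U} L t x.
Arguments new_x {U} L t x.
Arguments isolated_adjunction {U L} t x ML gamma M.

(* Main.v *)
(* Any structure satisfying (i)-(iii) has the following order: it extends the
   one of L, [new_top] is above everything, [new_x] is above exactly the
   elements of L that are below gamma, and only [new_x] and [new_top] are above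
   [new_x]. This gives uniqueness; for existence it suffices that this order has
   all infima. Moreover meeting an element of L with [new_x] or with gamma gives
   the same result, so a failure of distributivity at gamma carries over to
   [new_x]. *)
Require Import Defs.
From mathcomp Require Import all_boot.
From mathcomp Require Import boolp classical_sets.

Set Implicit Arguments.

Local Open Scope classical_set_scope.

(** * Complete lattices determined by their order or by their infima *)

Section CompleteLattice.
Variable T : Type.
Implicit Types (M : completeLattice T) (S : set T).

Lemma is_sup_eq {M S s} : (forall a, S a -> a <=[M] s) ->
  (forall b, (forall a, S a -> a <=[M] b) -> s <=[M] b) -> s = sup M S.
Proof.
move=> ub least; apply: (@le_anti _ M); rewrite least; last exact: sup_ub.
exact: sup_le_ub.
Qed.

Lemma is_inf_eq {M S s} : (forall a, S a -> s <=[M] a) ->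
  (forall b, (forall a, S a -> b <=[M] a) -> b <=[M] s) -> s = inf M S.
Proof.
move=> lb greatest; apply: (@le_anti _ M); rewrite greatest; last exact: inf_lb.
by rewrite lb_le_inf.
Qed.

(** Expresses the order through binary joins, so that an injective map preserving joins is seen to
    be an order embedding. *)
Lemma le_joinE M a b : (a <=[M] b) = (join M a b == b :> {classic T}).
Proof.
apply/idP/eqP => [ab|<-]; last by apply: sup_ub; left.
apply/esym/is_sup_eq => [c [->|->]//|c]; first exact: le_refl.
by apply; right.
Qed.

Lemma completeLattice_eq (M N : completeLattice T) : le M = le N -> M = N.
Proof.
move=> leMN.
have supMN : sup M = sup N.
  apply/funext => S; apply: is_sup_eq; rewrite -leMN => a; first exact: sup_ub.
  exact: sup_le_ub.
have infMN : inf M = inf N.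
  apply/funext => S; apply: is_inf_eq; rewrite -leMN => a; first exact: inf_lb.
  exact: lb_le_inf.
case: M N leMN supMN infMN => [l r an tr s s1 s2 i i1 i2].
case=> [l' r' an' tr' s' s1' s2' i' i1' i2'] /= el es ei; subst.
(* Once the data agree, only the proof fields can differ. *)
by f_equal; apply: Prop_irrelevance.
Qed.

(** The supremum of [S] is obtained as the infimum of its upper bounds; choice turns the existence
    of infima into an operation. *)
Lemma completeLattice_of_inf {r : rel T} :
  reflexive r -> antisymmetric r -> transitive r ->
  (forall S, exists i, (forall a, S a -> r i a) /\
     (forall b, (forall a, S a -> r b a) -> r b i)) ->
  exists M, le M = r.
Proof.
move=> rr ra rt /choice[i iP].
pose s S := i [set b | forall a, S a -> r a b].
have sub S a : S a -> r a (s S).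
  by move=> Sa; apply: (iP _).2 => b; apply.
have sleast S b : (forall a, S a -> r a b) -> r (s S) b.
  by move=> Sb; apply: (iP _).1.
by exists (CompleteLattice rr ra rt sub sleast
  (fun S => (iP S).1) (fun S => (iP S).2)).
Qed.

Lemma meet_lel M a b : meet M a b <=[M] a.
Proof. by apply: inf_lb; left. Qed.

Lemma meet_ler M a b : meet M a b <=[M] b.
Proof. by apply: inf_lb; right. Qed.

Lemma le_meet {M a b c} : c <=[M] a -> c <=[M] b -> c <=[M] meet M a b.
Proof. by move=> ca cb; apply: lb_le_inf => d [->|->]. Qed.

End CompleteLattice.

(** * The extended carrier and its order *)

Section Adjunction.
Variables (U : Type) (L : set U) (t x : U).
Hypothesis t_neq_x : t <> x.
Hypothesis disj : L `&` [set t; x] = set0.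
Variables (ML : completeLattice L) (gamma : L).

Local Notation Lb := (adjoin L t x).
Local Notation old := (old t x).
Local Notation X := (new_x L t x).
Local Notation Top := (new_top L t x).

Lemma old_inj {a b : L} : old a = old b -> a = b.
Proof. by move=> /(congr1 val) /= /val_inj. Qed.

Lemma old_neq_top (a : L) : old a <> Top.
Proof.
move=> /(congr1 val) /= at_.
suff: (set0 : set U) (val a) by [].
by rewrite -disj; split; [exact: (set_mem (valP a)) | left].
Qed.

Lemma old_neq_x (a : L) : old a <> X.
Proof.
move=> /(congr1 val) /= ax.
suff: (set0 : set U) (val a) by [].
by rewrite -disj; split; [exact: (set_mem (valP a)) | right].
Qed.

Lemma top_neq_x : Top <> X.
Proof. by move=> /(congr1 val). Qed.

Variant adjoin_spec : Lb -> Prop :=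
| AdjoinOld a : adjoin_spec (old a)
| AdjoinTop : adjoin_spec Top
| AdjoinX : adjoin_spec X.

Lemma adjoinP (u : Lb) : adjoin_spec u.
Proof.
case: (set_mem (valP u)) => [Lu|[ut|ux]].
- suff -> : u = old (elt Lu) by constructor.
  exact: val_inj.
- suff -> : u = Top by constructor.
  exact: val_inj.
- suff -> : u = X by constructor.
  exact: val_inj.
Qed.

(** Wrapped in a boolean because [le] is a [rel]. No disjunct puts [X] or [Top] below an element of
    [L]. *)
Definition adjoin_le (u v : Lb) : bool :=
  `[< [\/ exists a b, [/\ u = old a, v = old b & a <=[ML] b],
          exists a, [/\ u = old a, v = X & a <=[ML] gamma],
          v = Top | u = X /\ v = X] >].

Lemma adjoin_le_top u : adjoin_le u Top.
Proof. by apply/asboolP; apply: Or43. Qed.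

Lemma adjoin_le_xx : adjoin_le X X.
Proof. by apply/asboolP; apply: Or44. Qed.

Lemma adjoin_le_old a b : adjoin_le (old a) (old b) = (a <=[ML] b).
Proof.
apply/asboolP/idP => [[]|ab]; last by apply: Or41; exists a, b.
- by move=> [c [d [/old_inj -> /old_inj ->]]].
- by move=> [c [_ /old_neq_x]].
- by move=> /old_neq_top.
- by move=> [/old_neq_x].
Qed.

Lemma adjoin_le_old_x a : adjoin_le (old a) X = (a <=[ML] gamma).
Proof.
apply/asboolP/idP => [[]|ab]; last by apply: Or42; exists a.
- by move=> [c [d [_ /esym /old_neq_x]]].
- by move=> [c [/old_inj ->]].
- by move=> /esym /top_neq_x.
- by move=> [/old_neq_x].
Qed.

Lemma adjoin_le_x_old a : adjoin_le X (old a) = false.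
Proof.
apply/asboolP => -[].
- by move=> [c [d [/esym /old_neq_x]]].
- by move=> [c [/esym /old_neq_x]].
- by move=> /old_neq_top.
- by move=> [_ /old_neq_x].
Qed.

Lemma adjoin_le_top_old a : adjoin_le Top (old a) = false.
Proof.
apply/asboolP => -[].
- by move=> [c [d [/esym /old_neq_top]]].
- by move=> [c [/esym /old_neq_top]].
- by move=> /old_neq_top.
- by move=> [/top_neq_x].
Qed.

Lemma adjoin_le_top_x : adjoin_le Top X = false.
Proof.
apply/asboolP => -[].
- by move=> [c [d [/esym /old_neq_top]]].
- by move=> [c [/esym /old_neq_top]].
- by move=> /esym /top_neq_x.
- by move=> [/top_neq_x].
Qed.

Definition adjoin_leE := (adjoin_le_top, adjoin_le_xx, adjoin_le_old,
  adjoin_le_old_x, adjoin_le_x_old, adjoin_le_top_old, adjoin_le_top_x).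

Lemma adjoin_le_refl : reflexive adjoin_le.
Proof. by move=> u; case: (adjoinP u) => *; rewrite adjoin_leE ?le_refl. Qed.

Lemma adjoin_le_anti : antisymmetric adjoin_le.
Proof.
move=> u v; case: (adjoinP u) => [a||]; case: (adjoinP v) => [b||];
  by rewrite !adjoin_leE ?andbF // => /(@le_anti _ ML) ->.
Qed.

Lemma adjoin_le_trans : transitive adjoin_le.
Proof.
move=> v u w; case: (adjoinP u) => [a||]; case: (adjoinP v) => [b||];
  case: (adjoinP w) => [c||]; rewrite !adjoin_leE //; exact: le_trans.
Qed.

(** [L] is a down-set of the new order: a lower bound of a set that meets [L] stays in [L]. *)
Lemma adjoin_le_oldP {u a} : adjoin_le u (old a) -> exists b, u = old b.
Proof.
by case: (adjoinP u) => [b||]; rewrite !adjoin_leE // => _; exists b.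
Qed.

Lemma adjoin_le_inf (S : set Lb) : exists i : Lb,
  (forall a, S a -> adjoin_le i a) /\
  (forall b, (forall a, S a -> adjoin_le b a) -> adjoin_le b i).
Proof.
have [[a0 Sa0]|noold] := pselect (exists a, S (old a)).
  (* All lower bounds now lie in [L], where being below [X] means being below [gamma]. So [gamma]
     stands in for [X], and the infimum is taken in [ML]. *)
  exists (old (inf ML [set a | S (old a) \/ (S X /\ a = gamma)])); split.
    move=> u; case: (adjoinP u) => [a||] Su; rewrite adjoin_leE //.
    - by apply: inf_lb; left.
    - by apply: inf_lb; right.
  move=> v vlb; have [b vb] := adjoin_le_oldP (vlb _ Sa0).
  rewrite {}vb {v} in vlb *; rewrite adjoin_leE.
  apply: lb_le_inf => a [/vlb|[/vlb + ->]]; by rewrite adjoin_leE.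
(* Here [S] is contained in the chain of [X] and [Top]: its infimum is [X] if [X] belongs to it, and
   [Top] otherwise, also when [S] is empty. *)
have [SX|SX] := pselect (S X).
  exists X; split=> [u|v]; last by apply.
  by case: (adjoinP u) => [a||] Su; rewrite adjoin_leE //; case: noold; exists a.
exists Top; split=> [u|v]; last by rewrite adjoin_leE.
by case: (adjoinP u) => [a||] Su; rewrite adjoin_leE //; case: noold; exists a.
Qed.

(** * Existence: this order satisfies the three conditions *)

Lemma inclusion_old (AB : L `<=` Lb) : inclusion AB = old.
Proof. by apply/funext => a; apply: val_inj. Qed.

Lemma adjunction_of_le (M : completeLattice Lb) :
  le M = adjoin_le -> isolated_adjunction t x ML gamma M.
Proof.
move=> leM; split.
- exists (@sub_adjoin U L t x); split=> [S|S [a0 Sa0]]; rewrite inclusion_old.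
    apply: is_sup_eq; rewrite leM.
      by move=> _ [a Sa <-]; rewrite adjoin_leE; apply: sup_ub.
    (* [X] bounds a subset of [L] exactly when [gamma] does, so upper bounds in [L] and the upper
       bound [X] both reduce to [sup_le_ub] in [ML]. *)
    move=> u; case: (adjoinP u) => [b||] ub; rewrite adjoin_leE //;
      apply: sup_le_ub => a Sa; have := ub (old a);
      by rewrite adjoin_leE; apply; exists a.
  apply: is_inf_eq; rewrite leM.
    by move=> _ [a Sa <-]; rewrite adjoin_leE; apply: inf_lb.
  (* The element [a0] of the nonempty set forces the lower bound into [L]; the empty meet would be
     [Top]. *)
  move=> u lb; have [|b ub] := @adjoin_le_oldP u a0; first by apply: lb; exists a0.
  rewrite {}ub {u} in lb *; rewrite adjoin_leE; apply: lb_le_inf => a Sa.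
  by rewrite -adjoin_le_old; apply: lb; exists a.
- by move=> u; rewrite leM adjoin_leE.
- split.
  + split=> [Xbot|Xtop].
      have : bot M <=[M] old gamma by exact: sup_le_ub.
      by rewrite -Xbot leM adjoin_leE.
    have : Top <=[M] top M by exact: lb_le_inf.
    by rewrite -Xtop leM adjoin_leE.
  + by rewrite leM adjoin_leE le_refl.
  + by rewrite leM adjoin_leE.
  + apply/seteqP; split=> u /=; rewrite /Defs.down /= leM;
      case: (adjoinP u) => [a||]; rewrite !adjoin_leE //.
    * by case.
    * by case.
    * by case.
    * by move=> ag; split=> //; apply: old_neq_x.
  + apply/seteqP; split=> u /=; rewrite /up /= leM;
      case: (adjoinP u) => [a||]; rewrite !adjoin_leE //.
    * by case.
    * by case.
    * by move=> _; split=> //; apply: top_neq_x.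
Qed.

(** * Order, joins and meets of an arbitrary isolated adjunction *)

Section Structure.
Variable M : completeLattice Lb.
Hypothesis adjM : isolated_adjunction t x ML gamma M.

Lemma join_old a b : join M (old a) (old b) = old (join ML a b).
Proof.
have [[AB [supE _]] _ _] := adjM.
have := supE [set a; b]; rewrite inclusion_old /join => ->.
by rewrite image_setU !image_set1.
Qed.

Lemma le_adjoin : le M = adjoin_le.
Proof.
have [_ topM [_ _ _ downX upX]] := adjM.
have top_max u : Top <=[M] u -> u = Top.
  by move=> tu; apply: (@le_anti _ M); rewrite tu topM.
(* Join preservation and injectivity of [old] transfer the equation of [le_joinE] in both
   directions. *)
have le_old a b : (old a <=[M] old b) = (a <=[ML] b).
  apply/idP/idP; rewrite !le_joinE join_old => /eqP abE; apply/eqP;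
    last by rewrite abE.
  exact: old_inj abE.
apply/funext => u; apply/funext => v.
case: (adjoinP u) => [a||]; case: (adjoinP v) => [b||]; rewrite !adjoin_leE ?topM //.
- rewrite -le_old; apply/idP/idP => aX.
    have : (Defs.down M X `\ X) (old a) by split=> //; apply: old_neq_x.
    by rewrite downX.
  have : Defs.down M (old gamma) (old a) by [].
  by rewrite -downX => -[].
- by apply/negP => /top_max /old_neq_top.
- by apply/negP => /top_max /esym /top_neq_x.
(* An element of [L] above [X] would be strictly above it, hence above [x^+], which is [Top]. *)
- apply/negP => Xb.
  have : (up M X `\ X) (old b) by split=> //; apply: old_neq_x.
  by rewrite upX => /top_max /old_neq_top.
- exact: le_refl.
Qed.

(** A lower bound of [X] and [old a] lies in [L], and there being below [X] amounts to being below
    [gamma]. *)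
Lemma meet_x_old a : meet M X (old a) = old (meet ML gamma a).
Proof.
apply/esym/is_inf_eq; rewrite le_adjoin.
  by move=> u [->|->]; rewrite adjoin_leE ?meet_lel ?meet_ler.
move=> u lb; have [|b ub] := @adjoin_le_oldP u a; first by apply: lb; right.
rewrite {}ub {u} in lb *; rewrite adjoin_leE; apply: le_meet.
  by rewrite -adjoin_le_old_x; apply: lb; left.
by rewrite -adjoin_le_old; apply: lb; right.
Qed.

End Structure.

Lemma isolated_adjunction_exists : exists M, isolated_adjunction t x ML gamma M.
Proof.
have [M leM] := completeLattice_of_inf adjoin_le_refl adjoin_le_anti
  adjoin_le_trans adjoin_le_inf.
by exists M; apply: adjunction_of_le.
Qed.

End Adjunction.

Theorem lemma2p2 (U : Type) (L : set U) (ML : completeLattice L) (t x : U)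
    (t_neq_x : t <> x) (disj : L `&` [set t; x] = set0) (gamma : L) :
  (exists! M : completeLattice (adjoin L t x),
     isolated_adjunction t x ML gamma M) /\
  (forall M : completeLattice (adjoin L t x),
     isolated_adjunction t x ML gamma M ->
     forall alpha beta : L,
       ~ (meet ML gamma (join ML alpha beta)
            <=[ML] join ML (meet ML gamma alpha) (meet ML gamma beta)) ->
       let X := new_x L t x in
       let a := old t x alpha in
       let b := old t x beta in
       [/\ ~ (meet M X (join M a b) <=[M] join M (meet M X a) (meet M X b)),
           ~ (X <=[M] join M a b) &
           strictly_nondistributive M]).
Proof.
split.
  have [M adjM] := isolated_adjunction_exists t_neq_x disj ML gamma.
  exists M; split=> // N adjN; apply: completeLattice_eq.
  by rewrite (le_adjoin t_neq_x disj adjM)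
             (le_adjoin t_neq_x disj adjN).
move=> M adjM alpha beta nd X a b.
have leM := le_adjoin t_neq_x disj adjM.
have nondistr :
    ~ (meet M X (join M a b) <=[M] join M (meet M X a) (meet M X b)).
  (* Every join and meet moves inside [old], which leaves the assumed failure in [ML]. *)
  rewrite (join_old adjM).
  rewrite !(meet_x_old t_neq_x disj adjM).
  by rewrite (join_old adjM) leM adjoin_le_old.
(* The join of [a] and [b] is again in [L], and nothing in [L] is above [X]. *)
have X_nle : ~ (X <=[M] join M a b).
  by rewrite (join_old adjM) leM adjoin_le_x_old.
by split=> //; exists a, b, X.
Qed.
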